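(* For $\lambda>0$ let $N_\lambda,N'_\lambda$ be independent Poisson random variables with parameter $\lambda$, let $Y_\lambda=N_\lambda-N'_\lambda$, and set $$P_\lambda=P\left\{|Y_\lambda-E[Y_\lambda]|\le\sqrt{\mathrm{Var}(Y_\lambda)}\right\},\qquad P^0_\lambda=P\left\{|Y_\lambda-E[Y_\lambda]|<\sqrt{\mathrm{Var}(Y_\lambda)}\right\}.$$ Then $$\inf_{\lambda>0}P_\lambda=\inf_{\lambda>0}P^0_\lambda=P^0_{1/2}=e^{-1}\sum_{k=0}^\infty\frac{1}{2^{2k}(k!)^2}.$$ Consequently, with $\mathcal I$ the set of all infinitely divisible real random variables $X$ with $E[X^2]<\infty$ and $P_{\mathcal I}=\inf_{X\in\mathcal I}P\{|X-E[X]|\le\sqrt{\mathrm{Var}(X)}\}$, we have $P_{\mathcal I}\le e^{-1}\sum_{k=0}^\infty\frac{1}{2^{2k}(k!)^2}$.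
   Context: A real random variable is infinitely divisible if for every $n\ge1$ its distribution equals that of a sum of $n$ i.i.d. random variables. *)

(* Defs.v *)
From HB Require Import structures.
From mathcomp Require Import all_boot all_order all_algebra.
From mathcomp Require Import all_classical all_reals all_analysis.
Set Implicit Arguments. Unset Strict Implicit. Unset Printing Implicit Defensive.
Import Order.TTheory GRing.Theory Num.Theory.
Import numFieldNormedType.Exports.
Local Open Scope classical_set_scope.
Local Open Scope ring_scope.

Section defs.
Context {R : realType}.

(* The Poisson law with parameter l on nat (library's poisson_prob; its
   second argument is unused). *)
Definition poissonN (l : R) := @poisson_prob R l 0%N.

(* Canonical model of two independent Poisson(l) variables N, N':
   the product probability on nat * nat, N = fst, N' = snd. *)
Definition pairP (l : R) := (poissonN l \x poissonN l)%E.

Definition Ydiff (w : nat * nat) : R := (w.1)%:R - (w.2)%:R.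

Definition within_sd d (T : measurableType d) (P : probability T R)
  (X : T -> R) : \bar R :=
  P [set w | `|X w - fine 'E_P[X]| <= Num.sqrt (fine 'V_P[X])].

Definition within_sd_strict d (T : measurableType d) (P : probability T R)
  (X : T -> R) : \bar R :=
  P [set w | `|X w - fine 'E_P[X]| < Num.sqrt (fine 'V_P[X])].

Definition P_lam (l : R) : \bar R := within_sd (pairP l) Ydiff.
Definition P0_lam (l : R) : \bar R := within_sd_strict (pairP l) Ydiff.

Definition mutually_independent d (T : measurableType d)
  (P : probability T R) (n : nat) (Z : 'I_n -> T -> R) :=
  forall B : 'I_n -> set R, (forall i, measurable (B i)) ->
    P (\bigcap_(i in [set: 'I_n]) (Z i @^-1` B i)) =
    (\prod_(i < n) P (Z i @^-1` B i))%E.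

Definition identically_distributed d (T : measurableType d)
  (P : probability T R) (n : nat) (Z : 'I_n -> T -> R) :=
  forall i j (B : set R), measurable B -> P (Z i @^-1` B) = P (Z j @^-1` B).

Definition infinitely_divisible d (T : measurableType d)
  (P : probability T R) (X : T -> R) :=
  forall n : nat, (0 < n)%N ->
    exists (d' : measure_display) (T' : measurableType d')
           (P' : probability T' R) (Z : 'I_n -> T' -> R),
      [/\ forall i, measurable_fun setT (Z i),
          mutually_independent P' Z,
          identically_distributed P' Z &
          forall B : set R, measurable B ->
            P (X @^-1` B) = P' ((fun w => \sum_(i < n) Z i w) @^-1` B)].

Definition ID_values : set (\bar R) :=
  [set p | exists (d : measure_display) (T : measurableType d)
             (P : probability T R) (X : T -> R),
     [/\ measurable_fun setT X, infinitely_divisible P X,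
         X \in Lfun P 2%:E & p = within_sd P X]].

Definition P_I : \bar R := ereal_inf ID_values.

Definition c_const : \bar R :=
  ((expR (-1))%:E *
   \sum_(0 <= k <oo) (((2 ^+ (2 * k) * (k`!) ^+ 2)%:R : R)^-1)%:E)%E.

End defs.

(* Main.v *)
Require Import Defs.
From HB Require Import structures.
From mathcomp Require Import all_boot all_order all_algebra.
From mathcomp Require Import all_classical all_reals all_analysis.
From mathcomp Require Import ring lra zify.
Import Order.TTheory GRing.Theory Num.Theory.
Import numFieldNormedType.Exports.
Local Open Scope classical_set_scope.
Local Open Scope ring_scope.

(* Write t = 2 l for the variance of Y and p k = P(Y = k), so that the event
   |Y| < sqrt t is |Y| <= m when m^2 < t <= (m + 1)^2.  The law of Y is
   symmetric and unimodal, i.e. a mixture of uniform laws on {-j, ..., j}, and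
   this gives a discrete Gauss inequality: P(|Y| <= m) is at least about
   (2 m + 1) / sqrt (12 t + 1).  For m >= 2, and for m = 1 with t <= 16/5, this
   is at least 10/21, whereas e^-1 I_0(1) <= 19/40.  For m = 1 and
   16/5 <= t <= 4 partial sums of the series of p 0 and p 1 suffice.  For m = 0
   the probability is e^-t I_0(t), which on t <= 1 is minimal at t = 1; it tends
   to this minimum as t increases to 1, where |Y| <= sqrt t still means Y = 0.
   Infinite divisibility of Y comes from the convolution semigroup of Poisson
   laws and an iterated product space. *)

(** * Mixtures of uniform laws and the weight of the discrete Gauss inequality *)

(** Abel summation: with [G j] the sum in the last hypothesis, the expression equals [p J * G J]
    plus the sum over [j < J] of [(p j - p j.+1) * G j]. So it is enough to test [g] against each
    uniform law on {-j, ..., j}. *)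
Lemma abel_sum_ge0 {R : realFieldType} (p g : nat -> R) (J : nat) :
  (forall k, 0 <= p k) -> (forall k, p k.+1 <= p k) ->
  (forall j, 0 <= g 0%N + 2 * \sum_(k < j) g k.+1) ->
  0 <= p 0%N * g 0%N + 2 * \sum_(k < J) p k.+1 * g k.+1.
Proof.
move=> p0 dp G0.
suff : p J * (g 0%N + 2 * \sum_(k < J) g k.+1) <=
    p 0%N * g 0%N + 2 * \sum_(k < J) p k.+1 * g k.+1.
  by apply: le_trans; rewrite mulr_ge0.
elim: J => [|J IH]; first by rewrite !big_ord0 !mulr0 !addr0.
rewrite !big_ord_recr /=.
have := mulr_ge0 (_ : 0 <= p J - p J.+1) (G0 J).
rewrite subr_ge0 dp => /(_ isT).
move: (\sum_(k < J) g k.+1) (\sum_(k < J) p k.+1 * g k.+1) IH => A B.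
nra.
Qed.

Section gauss_weight.
Context {R : realFieldType}.
Variables (m : nat) (s : R).
Hypotheses (s0 : 0 < s) (ms : (2 * (m%:R : R) + 1) / s <= 2 / 3).

(* [gauss_slope] and [gauss_const] come from the tangent line at
   [v = (s ^ 2 - 1) / 12] to the convex function
   [v |-> (2 m + 1) / sqrt (12 v + 1)], which is the mass that the uniform law of
   variance [v = j (j + 1) / 3] on [{-j, ..., j}] gives to [{-m, ..., m}] when
   [j >= m]. *)
Definition gauss_slope : R := 6 * ((2 * m%:R + 1) / s) / s ^+ 2.
Definition gauss_const : R :=
  (2 * m%:R + 1) / s * (3 / 2 - 1 / (2 * s ^+ 2)).

(** The mean of this weight at [|Y|] is [P(|Y| <= m) - gauss_const + gauss_slope * Var Y], so the
    Gauss inequality says that the mean is nonnegative. *)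
Definition gauss_weight (k : nat) : R :=
  (k <= m)%N%:R - gauss_const + gauss_slope * k%:R ^+ 2.

Lemma gauss_weight_sum (j : nat) :
  gauss_weight 0 + 2 * \sum_(k < j) gauss_weight k.+1 =
  2 * (minn j m)%:R + 1
  - (2 * j%:R + 1) * gauss_const
  + gauss_slope * (j%:R * (j%:R + 1) * (2 * j%:R + 1) / 3).
Proof.
elim: j => [|j IH].
  by rewrite big_ord0 /gauss_weight min0n /= expr0n /=; field.
rewrite big_ord_recr /= mulrDr addrA IH /gauss_weight.
have -> : (minn j.+1 m)%:R = (minn j m)%:R + (j.+1 <= m)%N%:R :> R.
  rewrite -natrD; congr (_%:R); case: (leqP j.+1 m) => jm.
    by rewrite (minn_idPl (ltnW jm)) addn1.
  by rewrite (minn_idPr _) ?addn0.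
by rewrite -!(natr1 j); field.
Qed.

(** In terms of [x = (2 j + 1) / s] the sum is [2 min(j, m) + 1 - (2 m + 1) * x (3 - x^2) / 2]. For
    [j >= m], use [x^3 - 3 x + 2 = (x - 1)^2 (x + 2)]. For [j < m], divide by [2 j + 1]; then [ms]
    bounds [(2 m + 1) / s * 3 / 2] by 1. *)
Lemma gauss_weight_sum_ge0 (j : nat) :
  0 <= gauss_weight 0 + 2 * \sum_(k < j) gauss_weight k.+1.
Proof.
rewrite gauss_weight_sum.
pose u : R := 2 * j%:R + 1; pose x := u / s.
have u0 : 0 < u by rewrite /u; have := ler0n R j; lra.
have x0 : 0 < x by rewrite divr_gt0.
rewrite [leRHS](_ : _ = 2 * (minn j m)%:R + 1 -
    (2 * m%:R + 1) * (x * (3 - x ^+ 2) / 2)); last first.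
  by rewrite /gauss_const /gauss_slope /x /u; field; rewrite gt_eqF.
have m0 := ler0n R m.
case: (leqP m j) => mj.
  rewrite subr_ge0 ler_piMr //.
  by have := mulr_ge0 (sqr_ge0 (x - 1)) (_ : 0 <= x + 2); nra.
have -> : (2 * m%:R + 1) * (x * (3 - x ^+ 2) / 2) =
    u * ((2 * m%:R + 1) / s * (3 - x ^+ 2) / 2).
  by rewrite /x; field; rewrite gt_eqF.
rewrite -/u subr_ge0 ler_piMr //; first exact: ltW.
have : 0 <= (2 * m%:R + 1) / s by rewrite divr_ge0 ?ltW //; lra.
have := sqr_ge0 x; move: ms; move: ((2 * m%:R + 1) / s) (x ^+ 2) => f y; nra.
Qed.
End gauss_weight.

(** * Integration on nat and nat * nat, and the Poisson law *)

Lemma measurable_nat_prod (A : set (nat * nat)) : measurable A.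
Proof.
rewrite (_ : A = \bigcup_i ([set i] `*` [set j | A (i, j)])).
  by apply: bigcup_measurable => i _; exact: measurableX.
by apply/seteqP; split=> [[i j] Aij|[i j] [_ _ [/= <-]]//]; exists i.
Qed.

Lemma measurable_fun_nat_prod d (T : sigmaRingType d) (f : nat * nat -> T) :
  measurable_fun setT f.
Proof. by move=> _ B mB; exact: measurable_nat_prod. Qed.

Section nat_measures.
Context {R : realType}.
Local Open Scope ereal_scope.

Lemma ge0_integral_nat (mu : {measure set nat -> \bar R}) (f : nat -> \bar R) :
  (forall k, 0 <= f k) -> \int[mu]_k f k = \sum_(k <oo) f k * mu [set k].
Proof.
move=> f0; have UT : \bigcup_k [set k] = [set: nat].
  by apply/seteqP; split => // k _; exists k.
rewrite -UT ge0_integral_bigcup //; last by move=> i j _ _ [k [/= -> ->]].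
apply: eq_eseriesr => k _.
rewrite (eq_integral (cst (f k))); last by move=> x; rewrite inE /= => ->.
by rewrite integral_cst.
Qed.

Lemma ge0_integral_nat_prod (mu nu : probability nat R)
    (f : nat * nat -> \bar R) :
  (forall w, 0 <= f w) ->
  \int[mu \x nu]_w f w = \int[mu]_i \int[nu]_j f (i, j).
Proof.
by move=> f0; rewrite fubini_tonelli1 //; exact: measurable_fun_nat_prod.
Qed.

Lemma ge0_integral_nat_swap (mu nu : probability nat R)
    (f : nat -> nat -> \bar R) :
  (forall i j, 0 <= f i j) ->
  \int[mu]_i \int[nu]_j f i j = \int[nu]_j \int[mu]_i f i j.
Proof.
move=> f0; apply: (fubini_tonelli (m1 := mu) (m2 := nu)
  (fun w => f w.1 w.2)) => //.
exact: measurable_fun_nat_prod.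
Qed.

Lemma poissonN_set1 (l : R) k : (0 < l)%R ->
  poissonN l [set k] = (poisson_pmf l k)%:E.
Proof.
move=> l0; rewrite /poissonN /poisson_prob l0 esum_set1 // lee_fin.
exact: poisson_pmf_ge0.
Qed.

Lemma poisson_pmfS (l : R) k : (0 < l)%R ->
  (k.+1%:R * poisson_pmf l k.+1 = l * poisson_pmf l k)%R.
Proof.
move=> l0; rewrite /poisson_pmf l0 exprS factS natrM.
by field; rewrite nat1r !pnatr_eq0 -lt0n fact_gt0.
Qed.

Lemma integral_poisson (l : R) (f : nat -> \bar R) : (0 < l)%R ->
  (forall k, 0 <= f k) ->
  \int[poissonN l]_k f k = \sum_(k <oo) (poisson_pmf l k)%:E * f k.
Proof.
move=> l0 f0; rewrite ge0_integral_nat //; apply: eq_eseriesr => k _.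
by rewrite muleC; congr *%E; exact: poissonN_set1.
Qed.

(* The Stein-Chen identity. *)
Lemma integral_poisson_shift (l : R) (f : nat -> \bar R) : (0 < l)%R ->
  (forall k, 0 <= f k) ->
  \int[poissonN l]_k (k%:R%:E * f k) = l%:E * \int[poissonN l]_k f k.+1.
Proof.
move=> l0 f0; rewrite !integral_poisson //; last first.
  by move=> k; rewrite mule_ge0 // lee_fin.
have p0 k : 0 <= (poisson_pmf l k)%:E by rewrite lee_fin poisson_pmf_ge0.
rewrite nneseries_recl //; last by move=> k _; rewrite !mule_ge0 // lee_fin.
rewrite mul0e mule0 add0e -nneseries_addn //; last first.
  by move=> k; rewrite !mule_ge0 // lee_fin.
rewrite -nneseriesZl; last by move=> k _; rewrite mule_ge0.
apply: eq_eseriesr => k _; rewrite addn1 !muleA -!EFinM.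
by rewrite -poisson_pmfS // [in RHS]mulrC.
Qed.

End nat_measures.

(* Locked so that comparing [skellam l k] with [skellam l' k] does not unfold the
   product measures. *)
HB.lock Definition skellam {R : realType} (l : R) (k : nat) : R :=
  fine (pairP l [set w | w.2 = (w.1 + k)%N]).

(** * Point masses of the difference of two independent Poisson variables *)

Section skellam.
Context {R : realType} (l : R).
Hypothesis l0 : (0 < l)%R.
Local Open Scope ereal_scope.
Local Notation a := (poisson_pmf l).

Lemma pairP_integral (A : set (nat * nat)) :
  pairP l A = \int[poissonN l]_i \int[poissonN l]_j (\1_A (i, j))%:E.
Proof.
transitivity (\int[pairP l]_w (\1_A w)%:E); last first.
  by apply: ge0_integral_nat_prod => w; rewrite lee_fin.
by rewrite integral_indic ?setIT //; exact: measurable_nat_prod.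
Qed.

Lemma pairP_swap (A : set (nat * nat)) :
  pairP l [set w | A (w.2, w.1)] = pairP l A.
Proof.
by rewrite !pairP_integral ge0_integral_nat_swap.
Qed.

Lemma pairP_fin_num (A : set (nat * nat)) : pairP l A \is a fin_num.
Proof.
apply: (@fin_num_measure _ _ R (pairP l : probability _ R)).
exact: measurable_nat_prod.
Qed.

Lemma skellamE k : (skellam l k)%:E = pairP l [set w | w.2 = (w.1 + k)%N].
Proof. by rewrite unlock fineK // pairP_fin_num. Qed.

Lemma skellam_ge0 k : (0 <= skellam l k)%R.
Proof. by rewrite unlock fine_ge0. Qed.

Let indic_graph k i j :
  \1_[set w | w.2 = (w.1 + k)%N] (i, j) = \1_[set (i + k)%N] j :> R.
Proof.
by rewrite !indicE; congr (_%:R)%R.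
Qed.

Lemma skellam_series k :
  (skellam l k)%:E = \sum_(j <oo) (a j * a (j + k))%:E.
Proof.
rewrite skellamE pairP_integral.
under eq_integral => i _.
  rewrite (_ : (fun j => _) = fun j => (\1_[set (i + k)%N] j)%:E); last first.
    by apply/funext => j; rewrite indic_graph.
  rewrite integral_indic // setIT.
  over.
rewrite integral_poisson //.
apply: eq_eseriesr => j _; rewrite EFinM; congr *%E.
exact: poissonN_set1.
Qed.
End skellam.

(** * Unimodality of the law of Y *)

Section skellam_unimodal.
Context {R : realType} (l : R).
Hypothesis l0 : (0 < l)%R.
Local Notation a := (poisson_pmf l).

Let a_ge0 k : 0 <= a k. Proof. exact: poisson_pmf_ge0. Qed.

(** The falling factorial makes this 0 for [i < k], so the reindexing [i = j + k] yields a series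
    over all [i]. *)
Definition shift_ratio k i : R := (i ^_ k)%:R / l ^+ k.

Let shift_ratio_ge0 k i : 0 <= shift_ratio k i.
Proof. by rewrite divr_ge0 // exprn_ge0 // ltW. Qed.

Let shift_ratio_le k i j : (i <= j)%N -> shift_ratio k i <= shift_ratio k j.
Proof.
move=> ij; rewrite ler_pM2r ?invr_gt0 ?exprn_gt0 // ler_nat !ffact_prod.
by apply: leq_prod => n _; exact: leq_sub2r.
Qed.

Lemma poisson_pmf_shift k (x : nat -> R) : (forall i, 0 <= x i) ->
  (\sum_(j <oo) (a j * x (j + k)%N)%:E =
   \sum_(i <oo) (shift_ratio k i * a i * x i)%:E)%E.
Proof.
move=> x0; have t0 i : (0 <= (shift_ratio k i * a i * x i)%:E)%E.
  by rewrite lee_fin mulr_ge0 // mulr_ge0.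
rewrite [RHS](nneseries_split 0%N k) // add0n big1_seq ?add0e; last first.
  move=> i /andP[_]; rewrite mem_index_iota => /andP[_ ik].
  by rewrite /shift_ratio ffact_small // !mul0r.
rewrite -nneseries_addn //; apply: eq_eseriesr => j _; congr (_ * _)%:E.
rewrite /shift_ratio /poisson_pmf l0 exprD.
have := ffact_fact (leq_addl j k); rewrite addnK => <-; rewrite natrM.
field; rewrite !pnatr_eq0 -!lt0n fact_gt0 ffact_gt0 leq_addl /=.
by rewrite gt_eqF // exprn_gt0.
Qed.

(** Termwise [2 a_i a_(i+1) <= a_i^2 + a_(i+1)^2], and the shifted sum of squares is at most the
    full one. *)
Lemma poisson_pmf_correlation1 :
  (\sum_(i <oo) (a i * a i.+1)%:E <= \sum_(i <oo) (a i * a i)%:E)%E.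
Proof.
have aa0 i j : (0 <= (a i * a j)%:E)%E by rewrite lee_fin mulr_ge0.
have le_shift : (\sum_(i <oo) (a i.+1 * a i.+1)%:E <=
    \sum_(i <oo) (a i * a i)%:E)%E.
  rewrite [leRHS]nneseries_recl // -(@nneseries_addn _ _ 1%N) //.
  by under [in leRHS]eq_eseriesr => i _ do rewrite addn1; rewrite leeDr.
apply: (@le_trans _ _
  (\sum_(i <oo) ((2^-1)%:E * ((a i * a i)%:E + (a i.+1 * a i.+1)%:E)))%E).
  apply: lee_nneseries => // i _; rewrite -EFinD -EFinM lee_fin.
  by have := sqr_ge0 (a i - a i.+1); nra.
rewrite nneseriesZl => [|i _]; last by rewrite adde_ge0.
rewrite nneseriesD //.
apply: (@le_trans _ _ ((2^-1)%:E *
  (\sum_(i <oo) (a i * a i)%:E + \sum_(i <oo) (a i * a i)%:E))%E).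
  by rewrite lee_pmul2l // leeD2l.
have S0 : (0 <= \sum_(i <oo) (a i * a i)%:E)%E by exact: nneseries_ge0.
rewrite ge0_muleDr // -ge0_muleDl ?lee_fin // -EFinD.
by rewrite (_ : 2^-1 + 2^-1 = 1 :> R) ?mul1e //; field.
Qed.

(* [shift_ratio k i = a (i - k) / a i] increases with [i] while [a i - a i.+1]
   changes sign once, from - to +, at [M = floor l]; hence the termwise bound
   [(shift_ratio k i - shift_ratio k M) * (a i - a i.+1) >= 0]. *)
Lemma skellam_unimodal k : skellam l k.+1 <= skellam l k.
Proof.
rewrite -lee_fin !skellam_series //.
under eq_eseriesr => j _ do rewrite addnS.
rewrite (poisson_pmf_shift k (fun i => a i.+1)) //.
rewrite (poisson_pmf_shift k a) //.
pose M := Num.truncn l; pose rho := shift_ratio k M.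
have Ml : M%:R <= l < M.+1%:R by apply: truncn_itv; exact: ltW.
have term i : shift_ratio k i * a i * a i.+1 + rho * (a i * a i) <=
    shift_ratio k i * a i * a i + rho * (a i * a i.+1).
  suff : 0 <= a i * ((shift_ratio k i - rho) * (a i - a i.+1)) by nra.
  apply: mulr_ge0 => //.
  have aS := poisson_pmfS l i l0.
  have ai := a_ge0 i; have aSi := a_ge0 i.+1.
  have [Mi|iM] := leqP M i.
    have rM : rho <= shift_ratio k i by exact: shift_ratio_le.
    have li : l <= i.+1%:R.
      by rewrite (le_trans (ltW (proj2 (andP Ml)))) // ler_nat ltnS.
    apply: mulr_ge0; first by rewrite subr_ge0.
    rewrite subr_ge0 -(ler_pM2l (ltr0Sn R i)) aS.
    by rewrite ler_wpM2r.
  have rM : shift_ratio k i <= rho by apply: shift_ratio_le; exact: ltnW.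
  have li : i.+1%:R <= l.
    by rewrite (le_trans _ (proj1 (andP Ml))) // ler_nat.
  apply: mulr_le0; first by rewrite subr_le0.
  rewrite subr_le0 -(ler_pM2l (ltr0Sn R i)) aS.
  by rewrite ler_wpM2r.
have rho0 : 0 <= rho by exact: shift_ratio_ge0.
have S0fin : (\sum_(i <oo) (a i * a i)%:E)%E \is a fin_num.
  rewrite (_ : (\sum_(i <oo) _)%E = (skellam l 0)%:E) // skellam_series //.
  by apply: eq_eseriesr => i _; rewrite addn0.
have rS0fin : (rho%:E * \sum_(i <oo) (a i * a i)%:E)%E \is a fin_num.
  by rewrite fin_numM.
(* The finite quantity [rho * sum a_i^2] is added to both sides. Summing [term] then leaves only the
   comparison of the two correlation sums, scaled by [rho]. *)
rewrite -(leeD2rE _ _ rS0fin).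
have aa0 i j : (0 <= (a i * a j)%:E)%E by rewrite lee_fin mulr_ge0.
have raa0 i j : (0 <= (shift_ratio k i * a i * a j)%:E)%E.
  by rewrite lee_fin mulr_ge0 // mulr_ge0.
have rhoaa0 i j : (0 <= rho%:E * (a i * a j)%:E)%E by rewrite mule_ge0.
apply: (@le_trans _ _ (\sum_(i <oo) (shift_ratio k i * a i * a i)%:E +
    rho%:E * \sum_(i <oo) (a i * a i.+1)%:E)%E).
  rewrite -!nneseriesZl // -!nneseriesD //.
  apply: lee_nneseries => [i _ _|i _]; first by rewrite adde_ge0.
  by rewrite -!EFinM -!EFinD lee_fin.
by rewrite leeD2l // lee_wpmul2l // ?lee_fin // poisson_pmf_correlation1.
Qed.
End skellam_unimodal.

(** * Mean and variance of Y, and the events in terms of [|Y|] *)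

Lemma sqr_integrable_Lfun2 {R : realType} d (T : measurableType d)
    (mu : {measure set T -> \bar R}) (f : T -> R) :
  measurable_fun setT f -> (\int[mu]_x (f x ^+ 2)%:E < +oo)%E ->
  f \in Lfun mu 2%:E.
Proof.
move=> mf foo; rewrite inE; apply/andP; split; first by rewrite inE.
rewrite !inE /= /finite_norm unlock /Lnorm poweR_lty //=.
under eq_integral => x _.
  rewrite -[2]/(2%:R) powR_mulrn // real_normK ?num_real //.
  over.
exact: foo.
Qed.

Section skellam_moments.
Context {R : realType} (l : R).
Hypothesis l0 : (0 < l)%R.
Local Open Scope ereal_scope.
Local Notation P := (pairP l : probability _ R).

Lemma integral_poissonN_cst (r : R) : \int[poissonN l]_k r%:E = r%:E.
Proof.
rewrite integral_cst // [X in _ * X](_ : _ = 1) ?mule1 //.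
exact: (@probability_setT _ _ _ (poisson_prob l 0%N)).
Qed.

Lemma poisson_mean : \int[poissonN l]_k k%:R%:E = l%:E.
Proof.
transitivity (\int[poissonN l]_k (k%:R%:E * (1%R)%:E) : \bar R).
  by apply: eq_integral => k _; rewrite mule1.
by rewrite (integral_poisson_shift l (cst 1%:E)) // integral_poissonN_cst mule1.
Qed.

Lemma poisson_second_moment :
  \int[poissonN l]_k (k%:R ^+ 2)%:E = (l * (l + 1))%:E.
Proof.
transitivity (\int[poissonN l]_k (k%:R%:E * (k%:R)%:E) : \bar R).
  by apply: eq_integral => k _; rewrite -EFinM expr2.
rewrite (integral_poisson_shift l (fun k => k%:R%:E)) //.
rewrite EFinM; congr *%E.
under eq_integral => k _ do rewrite -natr1 EFinD.
rewrite ge0_integralD //.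
by rewrite poisson_mean integral_poissonN_cst EFinD.
Qed.

Lemma pairP_moment1 (f : nat -> R) : (forall k, (0 <= f k)%R) ->
  \int[pairP l]_w (f w.1)%:E = \int[poissonN l]_k (f k)%:E.
Proof.
move=> f0; rewrite ge0_integral_nat_prod => [|w]; last by rewrite lee_fin.
by apply: eq_integral => i _ /=; rewrite integral_poissonN_cst.
Qed.

Lemma pairP_moment2 (f : nat -> R) : (forall k, (0 <= f k)%R) ->
  \int[pairP l]_w (f w.2)%:E = \int[poissonN l]_k (f k)%:E.
Proof.
move=> f0; rewrite ge0_integral_nat_prod => [|w]; last by rewrite lee_fin.
rewrite ge0_integral_nat_swap => [|i j]; last by rewrite lee_fin.
by apply: eq_integral => i _ /=; rewrite integral_poissonN_cst.
Qed.

Lemma pairP_cross_moment :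
  \int[pairP l]_w (w.1%:R * w.2%:R)%:E = (l * l)%:E.
Proof.
rewrite ge0_integral_nat_prod => [|w]; last by rewrite lee_fin mulr_ge0.
under eq_integral => i _.
  under eq_integral => j _ do rewrite EFinM.
  rewrite ge0_integralZl_EFin //= poisson_mean muleC.
  over.
rewrite ge0_integralZl_EFin //; last exact: ltW.
  by rewrite poisson_mean EFinM.
by move=> k _; rewrite lee_fin; exact: (ler0n R k).
Qed.

(** The expansion of the square is used with the cross term moved to the other side, so that every
    integrand is nonnegative; the finite cross moment is subtracted at the end. *)
Lemma Ydiff_second_moment :
  \int[pairP l]_w (Ydiff w ^+ 2)%:E = (2 * l)%:E :> \bar R.
Proof.
have cross : \int[pairP l]_w (2 * (w.1%:R * w.2%:R))%:E = (2 * (l * l))%:E.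
  under eq_integral => w _ do rewrite EFinM.
  rewrite ge0_integralZl_EFin // ?pairP_cross_moment //.
  exact: measurable_fun_nat_prod.
have : \int[pairP l]_w (Ydiff w ^+ 2)%:E +
    \int[pairP l]_w (2 * (w.1%:R * w.2%:R))%:E =
    \int[pairP l]_w (w.1%:R ^+ 2)%:E + \int[pairP l]_w (w.2%:R ^+ 2)%:E :> \bar R.
  rewrite -!ge0_integralD //; do ?exact: measurable_fun_nat_prod;
    do ?by move=> w _; rewrite lee_fin ?sqr_ge0 // !mulr_ge0.
  by apply: eq_integral => w _; rewrite -!EFinD /Ydiff; congr EFin; ring.
rewrite cross (pairP_moment1 (fun k => k%:R ^+ 2)%R) //.
rewrite (pairP_moment2 (fun k => k%:R ^+ 2)%R) // poisson_second_moment.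
move/(congr1 (fun x => x - (2 * (l * l))%:E)); rewrite addeK // => ->.
by rewrite -!EFinD; congr EFin; ring.
Qed.

Lemma Ydiff_Lfun2 : (Ydiff : _ -> R) \in Lfun P 2%:E.
Proof.
apply: sqr_integrable_Lfun2; first exact: measurable_fun_nat_prod.
by rewrite Ydiff_second_moment ltry.
Qed.

Lemma Ydiff_mean : 'E_P[Ydiff] = 0.
Proof.
have X1 : (fun w : nat * nat => w.1%:R : R) \in Lfun P 2%:E.
  apply: sqr_integrable_Lfun2; first exact: measurable_fun_nat_prod.
  by rewrite (pairP_moment1 (fun k => k%:R ^+ 2)%R) // poisson_second_moment ltry.
have X2 : (fun w : nat * nat => w.2%:R : R) \in Lfun P 2%:E.
  apply: sqr_integrable_Lfun2; first exact: measurable_fun_nat_prod.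
  by rewrite (pairP_moment2 (fun k => k%:R ^+ 2)%R) // poisson_second_moment ltry.
have Pfin : P setT \is a fin_num by rewrite probability_setT.
rewrite (_ : Ydiff = (fun w => w.1%:R) \- (fun w => w.2%:R))%R //.
rewrite expectationB; [|exact: Lfun_subset12..].
rewrite unlock (pairP_moment1 (fun k => k%:R)%R) //.
by rewrite (pairP_moment2 (fun k => k%:R)%R) // poisson_mean subee.
Qed.

Lemma Ydiff_variance : 'V_P[Ydiff] = (2 * l)%:E.
Proof.
rewrite varianceE ?Ydiff_Lfun2 // Ydiff_mean expe2 mule0 sube0.
by rewrite unlock Ydiff_second_moment.
Qed.

(** This is [|Y|] as a natural number: with truncated subtraction at least one summand is 0. *)
Definition absdiff (w : nat * nat) : nat := (w.1 - w.2 + (w.2 - w.1))%N.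

Lemma normr_Ydiff w : (`|Ydiff w| = (absdiff w)%:R :> R)%R.
Proof.
case: w => i j; rewrite /Ydiff /absdiff /=; case: (leqP i j) => ij.
  rewrite distrC -natrB // ger0_norm //.
  by rewrite (_ : i - j = 0)%N //; apply/eqP; rewrite subn_eq0.
rewrite -natrB ?(ltnW ij) // ger0_norm //.
by rewrite (_ : j - i = 0)%N ?addn0 //; apply/eqP; rewrite subn_eq0 ltnW.
Qed.

Lemma P_lamE : P_lam l = pairP l [set w | (absdiff w)%:R <= Num.sqrt (2 * l)]%R.
Proof.
rewrite /P_lam /within_sd Ydiff_mean Ydiff_variance /=; congr (pairP l _).
by apply/seteqP; split=> w /=; rewrite subr0 normr_Ydiff.
Qed.

Lemma P0_lamE : P0_lam l = pairP l [set w | (absdiff w)%:R < Num.sqrt (2 * l)]%R.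
Proof.
rewrite /P0_lam /within_sd_strict Ydiff_mean Ydiff_variance /=.
congr (pairP l _).
by apply/seteqP; split=> w /=; rewrite subr0 normr_Ydiff.
Qed.

End skellam_moments.

(** * The discrete Gauss inequality for Y *)

Section skellam_gauss.
Context {R : realType} (l : R).
Hypothesis l0 : (0 < l)%R.
Local Open Scope ereal_scope.
Local Notation P := (pairP l : probability _ R).

Lemma absdiff0_law : pairP l [set w | absdiff w = 0%N] = (skellam l 0)%:E.
Proof.
rewrite skellamE; congr (pairP l _); apply/seteqP; split=> -[i j];
  rewrite /absdiff /= addn0; clear; lia.
Qed.

Lemma absdiffS_law k :
  pairP l [set w | absdiff w = k.+1] = (2 * skellam l k.+1)%:E.
Proof.
rewrite mulr_natl mulr2n EFinD skellamE.
rewrite -[in X in _ + X](pairP_swap l) -[RHS](@measureU _ _ _ P).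
- congr (pairP l _); apply/seteqP.
  by split=> -[i j]; rewrite /absdiff /=; clear; lia.
- exact: measurable_nat_prod.
- exact: measurable_nat_prod.
- by apply/seteqP; split=> -[i j] //=; clear; lia.
Qed.

Lemma absdiff_le1_law :
  pairP l [set w | (absdiff w <= 1)%N] = (skellam l 0 + 2 * skellam l 1)%:E.
Proof.
rewrite EFinD -absdiff0_law -absdiffS_law -[RHS](@measureU _ _ _ P).
- congr (pairP l _); apply/seteqP; split=> w /=; case: (absdiff w) => [|[|k]] //=.
  + by left.
  + by right.
  + by case.
- exact: measurable_nat_prod.
- exact: measurable_nat_prod.
- by apply/seteqP; split=> w //= -[->].
Qed.

(** The function [c(|Y|)] cut off beyond [J], whose integral is a finite sum of the shape handled by
    [abel_sum_ge0]. *)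
Let simple (c : nat -> R) (J : nat) w :=
  \sum_(k < J.+1) (c k * \1_[set w | absdiff w = k] w)%R%:E.

Let simpleE c J w : simple c J w =
  (if (absdiff w <= J)%N then c (absdiff w) else 0%R)%:E.
Proof.
rewrite /simple sumEFin; congr EFin; case: leqP => dJ.
  rewrite (bigD1 (Ordinal (dJ : (absdiff w < J.+1)%N))) //= big1 ?addr0.
    by rewrite indicE mem_set // mulr1.
  move=> k /eqP kd; rewrite indicE memNset ?mulr0 //= => dk.
  by apply: kd; exact/val_inj.
rewrite big1 // => k _; rewrite indicE memNset ?mulr0 //= => dk.
by have := ltn_ord k; rewrite -dk ltnS leqNgt dJ.
Qed.

Let simple_ge0 c J w : (forall k, (0 <= c k)%R) -> 0 <= simple c J w.
Proof. by move=> c0; rewrite simpleE lee_fin; case: ifP. Qed.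

Let integral_simple c J : (forall k, (0 <= c k)%R) ->
  \int[pairP l]_w simple c J w =
  (skellam l 0 * c 0%N + 2 * \sum_(k < J) skellam l k.+1 * c k.+1)%:E.
Proof.
move=> c0; rewrite ge0_integral_sum //; last 2 first.
- by move=> k; exact: measurable_fun_nat_prod.
- by move=> k w _; rewrite lee_fin mulr_ge0.
have step k : \int[pairP l]_w (c k * \1_[set w | absdiff w = k] w)%:E =
    (c k)%:E * pairP l [set w | absdiff w = k].
  under eq_integral => w _ do rewrite EFinM.
  rewrite ge0_integralZl_EFin //; last exact: measurable_fun_nat_prod.
  by rewrite integral_indic ?setIT //; exact: measurable_nat_prod.
rewrite big_ord_recl step absdiff0_law -EFinM mulrC EFinD; congr (_ + _).
under eq_bigr => k _ do rewrite step absdiffS_law -EFinM.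
rewrite sumEFin mulr_sumr; congr EFin; apply: eq_bigr => k _.
by rewrite mulrCA [X in (2 * X)%R]mulrC.
Qed.

(** By unimodality and [gauss_weight_sum_ge0], [abel_sum_ge0] makes the truncated mean of
    [gauss_weight] nonnegative; the variance [2 * l] accounts for the quadratic term. *)
Lemma gauss_bound (m : nat) (s : R) : (0 < s)%R ->
  ((2 * (m%:R : R) + 1) / s <= 2 / 3)%R -> (1 <= s)%R ->
  (gauss_const m s - gauss_slope m s * (2 * l))%:E <=
  pairP l [set w | (absdiff w <= m)%N].
Proof.
move=> s0 ms s1.
set al := gauss_const m s; set be := gauss_slope m s.
have m0 := ler0n R m.
have be0 : (0 < be)%R.
  by rewrite /be /gauss_slope divr_gt0 ?exprn_gt0 // mulr_gt0 // divr_gt0 //; lra.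
have al0 : (0 <= al)%R.
  apply: mulr_ge0; first by rewrite divr_ge0 ?ltW //; lra.
  have : (1 / (2 * s ^+ 2) <= 1 :> R)%R.
    by rewrite ler_pdivrMr; [nra|rewrite mulr_gt0 // exprn_gt0].
  lra.
(* Beyond [J] the weight is nonnegative, so that truncating there only loses
   mass. *)
pose J := (Num.truncn (al / be)).+1.
have J_large k : (J < k)%N -> (al <= be * k%:R ^+ 2)%R.
  move=> Jk; rewrite mulrC -ler_pdivrMr //.
  have : (al / be <= J%:R)%R.
    by apply: ltW; have /andP[] := truncn_itv (divr_ge0 al0 (ltW be0)).
  move=> /le_trans; apply.
  apply: (@le_trans _ _ k%:R); first by rewrite ler_nat ltnW.
  by rewrite -natrX ler_nat expnS expn1 leq_pmulr // (leq_trans _ Jk).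
pose c k : R := ((k <= m)%N%:R + be * k%:R ^+ 2)%R.
have c0 k : (0 <= c k)%R by rewrite addr_ge0 // mulr_ge0 ?sqr_ge0 // ltW.
have Iind : \int[pairP l]_w (\1_[set w | (absdiff w <= m)%N] w)%:E =
    pairP l [set w | (absdiff w <= m)%N].
  by rewrite integral_indic ?setIT //; exact: measurable_nat_prod.
have IY : \int[pairP l]_w (be * Ydiff w ^+ 2)%:E = (be * (2 * l))%:E.
  under eq_integral => w _ do rewrite EFinM.
  rewrite ge0_integralZl_EFin ?Ydiff_second_moment ?ltW //.
    by move=> w _; rewrite lee_fin sqr_ge0.
  exact: measurable_fun_nat_prod.
have beY w : 0 <= (be * Ydiff w ^+ 2)%:E.
  by rewrite lee_fin mulr_ge0 ?sqr_ge0 // ltW.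
have Ial : \int[pairP l]_w al%:E = al%:E.
  rewrite integral_cst // [X in _ * X](_ : _ = 1) ?mule1 //.
  exact: (@probability_setT _ _ _ P).
(* The truncated constant [al] stands on the right instead of being subtracted, which keeps all
   integrands nonnegative. Pointwise this is an equality for [|Y| <= J] and follows from [J_large]
   beyond. *)
have : \int[pairP l]_w (al%:E + simple c J w) <=
    \int[pairP l]_w ((\1_[set w | (absdiff w <= m)%N] w)%:E +
      (be * Ydiff w ^+ 2)%:E + simple (cst al) J w).
  apply: ge0_le_integral => //; do ?exact: measurable_fun_nat_prod.
  - by move=> w _; rewrite adde_ge0 ?simple_ge0 ?lee_fin.
  - move=> w _; rewrite !simpleE -!EFinD lee_fin.
    have -> : (Ydiff w ^+ 2 = (absdiff w)%:R ^+ 2 :> R)%R.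
      by rewrite -normr_Ydiff real_normK ?num_real.
    rewrite indicE; case: leqP => dJ.
      rewrite [leRHS]addrC lerD2l /c.
      rewrite (_ : (w \in _) = (absdiff w <= m)%N) //.
      by apply/idP/idP; rewrite inE.
    rewrite !addr0 -[leLHS]add0r lerD //; exact: J_large.
rewrite !ge0_integralD //; do ?exact: measurable_fun_nat_prod;
  do ?by move=> w _; rewrite ?adde_ge0 ?simple_ge0 // ?beY // lee_fin.
rewrite !integral_simple // Iind IY Ial.
have := abel_sum_ge0 (skellam l) (gauss_weight m s) J (skellam_ge0 l)
  (skellam_unimodal l l0) (gauss_weight_sum_ge0 m s s0 ms).
have Qfin := pairP_fin_num l [set w | (absdiff w <= m)%N].
rewrite -(fineK Qfin) -!EFinD !lee_fin.
have cE k : gauss_weight m s k = (c k - al)%R.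
  by rewrite /gauss_weight /c -/al -/be; ring.
have -> : (\sum_(k < J) skellam l k.+1 * gauss_weight m s k.+1 =
    \sum_(k < J) skellam l k.+1 * c k.+1 -
    \sum_(k < J) skellam l k.+1 * al :> R)%R.
  by rewrite -sumrB; apply: eq_bigr => k _; rewrite cE mulrBr.
rewrite cE /cst; lra.
Qed.

End skellam_gauss.

(** * Rational bounds for e *)

Section exp_bounds.
Context {R : realType}.

Lemma nneseries_le_bound (u : nat -> R) (M : R) : (forall k, 0 <= u k) ->
  (forall n, \sum_(k < n) u k <= M) -> (\sum_(k <oo) (u k)%:E <= M%:E)%E.
Proof.
move=> u0 uM; apply: lime_le.
  by apply: is_cvg_nneseries => k _ _; rewrite lee_fin.
by apply: nearW => n; rewrite sumEFin lee_fin big_mkord.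
Qed.

Lemma exp_coeff_sum_le (x : R) n : 0 <= x ->
  \sum_(k < n) x ^+ k / k`!%:R <= expR x.
Proof.
move=> x0; rewrite /expR.
have -> : \sum_(k < n) x ^+ k / k`!%:R = series (exp_coeff x) n.
  by rewrite /series /= big_mkord.
apply: nondecreasing_cvgn_le; last exact: is_cvg_series_exp_coeff.
by apply: nondecreasing_series => k _ _; exact: exp_coeff_ge0.
Qed.

Lemma expR1_ge : 8 / 3 <= expR 1 :> R.
Proof.
apply: le_trans (exp_coeff_sum_le 1 4 ler01).
by rewrite !big_ord_recr big_ord0 /= !factS fact0 !expr1n; lra.
Qed.

(** Since [(n + 2)! >= 2 * 3^n], the terms after [1 + 1] sum to at most
    [(1/2) / (1 - 1/3) = 3/4]. *)
Lemma expR1_le : expR 1 <= 11 / 4 :> R.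
Proof.
have fact_ge n : (2 * 3 ^ n <= (n.+2)`!)%N.
  elim: n => // n IH; rewrite factS expnS mulnCA.
  by rewrite leq_mul.
have bound n : \sum_(k < n.+2) (k`!%:R)^-1 <= 11 / 4 - 3 / 4 * (3^-1) ^+ n :> R.
  elim: n => [|n IH].
    by rewrite !big_ord_recr big_ord0 /= !factS fact0; lra.
  rewrite big_ord_recr /=; apply: le_trans (lerD IH (_ : _ <= 2^-1 * (3^-1) ^+ n)) _.
    rewrite exprVn -invfM -natrX -natrM lef_pV2 ?posrE ?ltr0n ?fact_gt0 //.
      by rewrite ler_nat fact_ge.
    by rewrite muln_gt0 expn_gt0.
  by rewrite exprS; lra.
rewrite {1}/expR; apply: limr_le; first exact: is_cvg_series_exp_coeff.
apply: nearW => n; rewrite /series /= big_mkord.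
apply: (@le_trans _ _ (\sum_(k < n.+2) (k`!%:R)^-1)).
  rewrite !big_ord_recr /= -addrA.
  rewrite (eq_bigr (fun k : 'I_n => (k`!%:R)^-1)); last first.
    by move=> k _; rewrite /exp_coeff /= expr1n div1r.
  by rewrite lerDl addr_ge0.
apply: le_trans (bound n) _.
by rewrite lerBlDr lerDl mulr_ge0 // exprn_ge0.
Qed.

End exp_bounds.

(** * The Bessel function I_0 on [0, 1] and the value of P(Y = 0) *)

Section bessel.
Context {R : realType}.

(* [\sum_k x ^ (2 k) * bessel_coeff k = I_0(x)]. *)
Definition bessel_coeff (k : nat) : R := ((2 ^+ (2 * k) * (k`!) ^+ 2)%:R)^-1.

Lemma bessel_coeffE k : bessel_coeff k = ((4 ^+ k) * (k`!%:R) ^+ 2)^-1.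
Proof.
rewrite /bessel_coeff; congr (_^-1).
rewrite natrM !natrXE !natrX exprM; congr (_ ^+ k * _).
by rewrite -natrX.
Qed.

Lemma bessel_coeff_gt0 k : 0 < bessel_coeff k.
Proof. by rewrite bessel_coeffE invr_gt0 mulr_gt0 ?exprn_gt0 // ltr0n fact_gt0. Qed.

Lemma bessel_coeff0 : bessel_coeff 0 = 1.
Proof. by rewrite bessel_coeffE expr0 fact0 expr1n mulr1 invr1. Qed.

Lemma bessel_coeffS k :
  bessel_coeff k.+1 = bessel_coeff k / (4 * k.+1%:R ^+ 2).
Proof.
rewrite !bessel_coeffE exprS factS natrM.
field; rewrite nat1r !pnatr_eq0 -!lt0n fact_gt0 /=.
by rewrite expf_neq0.
Qed.

Lemma bessel_coeffS_le k : bessel_coeff k.+1 <= 4^-1 * (16^-1) ^+ k.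
Proof.
elim: k => [|k IH].
  by rewrite bessel_coeffS bessel_coeff0 expr0 expr1n; lra.
rewrite bessel_coeffS (exprSr 16^-1) mulrA; apply: ler_pM => //.
  exact/ltW/bessel_coeff_gt0.
rewrite lef_pV2 ?posrE // ?mulr_gt0 ?exprn_gt0 //.
have : 2 <= k.+2%:R :> R by rewrite ler_nat.
by move: (k.+2%:R) => y y2; nra.
Qed.

(** The bound is [1 + (1/4) / (1 - 1/16)], from the geometric majorant [bessel_coeffS_le]. *)
Lemma bessel1_le : (\sum_(k <oo) (bessel_coeff k)%:E <= (19 / 15)%:E)%E.
Proof.
apply: nneseries_le_bound => [k|n]; first exact/ltW/bessel_coeff_gt0.
have bound m : \sum_(k < m.+1) bessel_coeff k <=
    19 / 15 - 4 / 15 * (16^-1) ^+ m.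
  elim: m => [|m IH]; first by rewrite big_ord_recr big_ord0 /= bessel_coeff0; lra.
  rewrite big_ord_recr /=; apply: le_trans (lerD IH (bessel_coeffS_le m)) _.
  by rewrite exprS; lra.
case: n => [|n]; first by rewrite big_ord0; lra.
by apply: le_trans (bound n) _; rewrite lerBlDr lerDl mulr_ge0 // exprn_ge0.
Qed.

Definition bessel (x : R) : \bar R :=
  (\sum_(k <oo) (x ^+ (2 * k) * bessel_coeff k)%:E)%E.

Lemma skellam0E (l : R) : 0 < l ->
  (skellam l 0)%:E = ((expR (- (2 * l)))%:E * bessel (2 * l))%E.
Proof.
move=> l0; rewrite skellam_series // -nneseriesZl => [|k _]; last first.
  rewrite lee_fin mulr_ge0 ?(ltW (bessel_coeff_gt0 k)) //.
  by rewrite exprM exprn_ge0 // sqr_ge0.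
apply: eq_eseriesr => k _; rewrite addn0 -EFinM; congr EFin.
have -> : - (2 * l) = - l + - l by ring.
have -> : (2 * l) ^+ (2 * k) = 4 ^+ k * (l ^+ k * l ^+ k).
  rewrite exprMn -exprD addnn -mul2n; congr (_ * _).
  by rewrite exprM; congr (_ ^+ _); ring.
rewrite expRD /poisson_pmf l0 bessel_coeffE.
by field; rewrite pnatr_eq0 -lt0n fact_gt0 expf_neq0.
Qed.

Lemma bessel1E : bessel 1 = (\sum_(k <oo) (bessel_coeff k)%:E)%E.
Proof. by apply: eq_eseriesr => k _; rewrite expr1n mul1r. Qed.

Lemma c_constE : c_const = (skellam (2^-1 : R) 0)%:E.
Proof.
rewrite skellam0E ?invr_gt0 // (_ : 2 * 2^-1 = 1 :> R); last by field.
by rewrite bessel1E.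
Qed.

Lemma bessel1_fin_num : bessel 1 \is a fin_num.
Proof.
rewrite bessel1E ge0_fin_numE; first exact: le_lt_trans bessel1_le (ltry _).
by apply: nneseries_ge0 => k _ _; rewrite lee_fin ltW // bessel_coeff_gt0.
Qed.

Lemma bessel_le1 (x : R) : 0 <= x <= 1 -> (bessel x <= bessel 1)%E.
Proof.
move=> /andP[x0 x1]; apply: lee_nneseries => k _.
  by rewrite lee_fin mulr_ge0 ?exprn_ge0 ?(ltW (bessel_coeff_gt0 k)).
by rewrite lee_fin ler_pM2r ?bessel_coeff_gt0 // expr1n exprn_ile1.
Qed.

(* By Bernoulli [1 - x ^ (2 k) <= 2 k (1 - x)], and
   [2 k * bessel_coeff k <= 2 ^- k]. *)
Lemma bessel1_le_bessel (x : R) : 0 <= x <= 1 ->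
  (bessel 1 <= bessel x + (1 - x)%:E)%E.
Proof.
move=> /andP[x0 x1].
have [h h2] : {h : R | h = 2^-1} by exists 2^-1.
have h0 : 0 <= h by lra.
(* The constant terms of the two series agree, so [d] vanishes at 0 and its total is 1. *)
pose d (k : nat) : R := (k != 0)%:R * h ^+ k.
have d0 k : 0 <= d k by rewrite mulr_ge0 // exprn_ge0.
have d1 : (\sum_(k <oo) (d k)%:E <= 1%:E)%E.
  apply: nneseries_le_bound => // n.
  have bound m : \sum_(k < m.+1) d k = 1 - h ^+ m.
    elim: m => [|m IH].
      by rewrite big_ord_recr big_ord0 /= /d mul0r expr0; lra.
    rewrite big_ord_recr IH /d /= mul1r exprS.
    by move: (h ^+ m); rewrite h2 => e; lra.
  case: n => [|n]; first by rewrite big_ord0.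
  by rewrite bound lerBlDr lerDl exprn_ge0.
apply: (@le_trans _ _
  (bessel x + (1 - x)%:E * \sum_(k <oo) (d k)%:E)%E); last first.
  by rewrite leeD2l // -[leRHS]mule1 lee_wpmul2l // lee_fin subr_ge0.
have bx0 k : 0 <= x ^+ (2 * k) * bessel_coeff k.
  by rewrite mulr_ge0 ?exprn_ge0 ?(ltW (bessel_coeff_gt0 k)).
rewrite -nneseriesZl => [|k _]; last by rewrite lee_fin.
rewrite /bessel -nneseriesD //; last 2 first.
- by move=> k _ _; rewrite lee_fin.
- by move=> k _ _; rewrite -EFinM lee_fin mulr_ge0 ?subr_ge0.
apply: lee_nneseries => k _.
  by rewrite lee_fin mulr_ge0 ?exprn_ge0 ?(ltW (bessel_coeff_gt0 k)).
rewrite -EFinM -EFinD lee_fin expr1n mul1r.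
case: k => [|k]; first by rewrite /d mul0r mulr0 addr0 expr0 mul1r.
rewrite /d mul1r.
have bern n : 1 - n%:R * (1 - x) <= x ^+ n.
  elim: n => [|n IH]; first by rewrite mul0r subr0 expr0.
  have : x ^+ n <= 1 by exact: exprn_ile1.
  have : 0 <= x ^+ n by exact: exprn_ge0.
  rewrite exprS -natr1; move: (x ^+ n) IH (ler0n R n) => y; nra.
have kb : (2 * k.+1)%:R * bessel_coeff k.+1 <= h ^+ k.+1.
  elim: k => [|k IH].
    by rewrite bessel_coeffS bessel_coeff0 expr1n muln1 expr1; lra.
  rewrite bessel_coeffS (exprS h) natrM -[k.+2%:R]natr1; move: IH; rewrite natrM.
  have : 1 <= k.+1%:R :> R by rewrite ler1n.
  have := bessel_coeff_gt0 k.+1.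
  move: (k.+1%:R : R) (bessel_coeff k.+1) (h ^+ k.+1) => y b e b0 y1 IH.
  have y0 : 0 < y by lra.
  rewrite [leLHS](_ : _ = 2 * y * b * (4 * y * (y + 1))^-1); last first.
    by field; rewrite !gt_eqF //; lra.
  rewrite [leRHS]mulrC; apply: ler_pM => //.
  - by rewrite !mulr_ge0 // ltW.
  - by rewrite invr_ge0 !mulr_ge0 //; lra.
  by rewrite h2 lef_pV2 ?posrE ?mulr_gt0 //; nra.
have := bern (2 * k.+1)%N; have := bessel_coeff_gt0 k.+1.
have : 0 <= h ^+ k.+1 by exact: exprn_ge0.
move: kb; move: ((2 * k.+1)%:R : R) (bessel_coeff _) (x ^+ _) => n b y.
move: (h ^+ _) => e; nra.
Qed.

(** The constant is [(19/15) / (8/3)]. *)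
Lemma skellam0_half_le : skellam (2^-1 : R) 0 <= 19 / 40.
Proof.
rewrite -lee_fin -c_constE /c_const.
apply: (@le_trans _ _ ((expR (-1))%:E * (19 / 15 : R)%:E)%E).
  by apply: lee_wpmul2l bessel1_le; rewrite lee_fin expR_ge0.
rewrite -EFinM lee_fin expRN.
have := @expR1_ge R; set e := expR 1 => e83.
have e0 : 0 < e by lra.
by rewrite mulrC ler_pdivrMr //; lra.
Qed.

(** With [x = 2 l] and [I_0(x) >= 1]: [I_0(1) <= I_0(x) + (1 - x) <= I_0(x) (2 - x) <= I_0(x) e^(1 -
    x)]. *)
Lemma skellam0_half_min (l : R) : 0 < l <= 2^-1 ->
  skellam (2^-1 : R) 0 <= skellam l 0.
Proof.
move=> /andP[l0 l2]; have x01 : 0 <= 2 * l <= 1 by lra.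
have half0 : 0 < 2^-1 :> R by rewrite invr_gt0.
rewrite -lee_fin (skellam0E _ l0) (skellam0E _ half0).
rewrite (_ : 2 * 2^-1 = 1 :> R); last by field.
have bfin : bessel (2 * l) \is a fin_num.
  rewrite ge0_fin_numE; last first.
    apply: nneseries_ge0 => k _ _; rewrite lee_fin mulr_ge0 //.
      by rewrite exprn_ge0 //; lra.
    exact/ltW/bessel_coeff_gt0.
  apply: le_lt_trans (bessel_le1 _ x01) _.
  by rewrite -ge0_fin_numE ?bessel1_fin_num // bessel1E nneseries_ge0 // => k _ _;
     rewrite lee_fin ltW // bessel_coeff_gt0.
have b1 : (1 <= bessel (2 * l))%E.
  rewrite /bessel nneseries_recl //.
    rewrite bessel_coeff0 expr0 mulr1 leeDl // nneseries_ge0 // => k _ _.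
    by rewrite lee_fin mulr_ge0 ?(ltW (bessel_coeff_gt0 _)) // exprn_ge0; lra.
  move=> k _.
  by rewrite lee_fin mulr_ge0 ?(ltW (bessel_coeff_gt0 _)) // exprn_ge0; lra.
have := bessel1_le_bessel _ x01.
rewrite -(fineK bfin) -(fineK bessel1_fin_num) -EFinD -!EFinM !lee_fin => bb.
move: b1; rewrite -(fineK bfin) lee_fin.
have -> : expR (- (2 * l)) = expR (-1) * expR (1 - 2 * l).
  by rewrite -expRD; congr expR; ring.
have := expR_ge1Dx (1 - 2 * l); have := expR_gt0 (-1 : R).
move=> e0 e1 b1; rewrite -mulrA ler_pM2l //.
by apply: (le_trans bb); nra.
Qed.

(** A reverse estimate from the monotonicity of I_0. Its factor tends to 1 as [l] increases to 1/2,
    which gives the infimum of [P_lam]. *)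
Lemma skellam0_le_half (l : R) : 0 < l <= 2^-1 ->
  skellam l 0 <= expR (1 - 2 * l) * skellam (2^-1 : R) 0.
Proof.
move=> /andP[l0 l2]; have x01 : 0 <= 2 * l <= 1 by lra.
have half0 : 0 < 2^-1 :> R by rewrite invr_gt0.
rewrite -lee_fin EFinM (skellam0E _ l0) (skellam0E _ half0).
rewrite (_ : 2 * 2^-1 = 1 :> R); last by field.
rewrite muleA -EFinM -expRD (_ : 1 - 2 * l + -1 = - (2 * l)); last by ring.
by apply: lee_wpmul2l; [rewrite lee_fin expR_ge0|exact: bessel_le1].
Qed.

End bessel.

(** * The lower bound for [P0_lam], by cases on m *)

(** The choice [s = 7/2 (m + 1)] gives [s^2 = 49/4 (m + 1)^2 >= 12 t + 1], because [(m + 1)^2 >= 4].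
    The bound is then at least [(2 m + 1) / s = 4/7 - (2/7) / (m + 1)], which is 10/21 at [m = 2]
    and increases with [m]. *)
Lemma gauss_value {R : realFieldType} (m : nat) (t : R) :
  2 <= (m%:R : R) -> t <= (m%:R + 1) ^+ 2 ->
  (2 * m%:R + 1) / (7 / 2 * (m%:R + 1)) <= 2 / 3 :> R /\
  10 / 21 <= gauss_const m (7 / 2 * (m%:R + 1)) -
    gauss_slope m (7 / 2 * (m%:R + 1)) * t.
Proof.
rewrite /gauss_const /gauss_slope; move: (m%:R : R) => x x2 xt.
have x0 : 0 < x + 1 by lra.
pose f := (2 * x + 1) / (7 / 2 * (x + 1)).
have fE : f = 4 / 7 - 2 / 7 * (x + 1)^-1 by rewrite /f; field; rewrite gt_eqF.
have v_le : (x + 1)^-1 <= 3^-1 by rewrite lef_pV2 ?posrE //; lra.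
have v_gt0 : 0 < (x + 1)^-1 by rewrite invr_gt0.
have f1 : f <= 2 / 3 by rewrite fE; lra.
have f2 : 10 / 21 <= f by rewrite fE; lra.
split=> //; rewrite -/f.
rewrite [leRHS](_ : _ = f * (3 / 2 - 2 / 49 * ((1 + 12 * t) / (x + 1) ^+ 2))).
  apply: (le_trans f2); rewrite ler_peMr //; first lra.
  have : (1 + 12 * t) / (x + 1) ^+ 2 <= 49 / 4.
    by rewrite ler_pdivrMr ?exprn_gt0 //; nra.
  lra.
by move: f {fE f1 f2} => f; field; rewrite gt_eqF.
Qed.

Section lower_bound.
Context {R : realType} (l : R).
Hypothesis l0 : 0 < l.
Local Notation P := (pairP l : probability _ R).

Lemma le_pairP (A B : set (nat * nat)) : A `<=` B -> (pairP l A <= pairP l B)%E.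
Proof.
by move=> AB; apply: (@le_measure _ _ _ P); rewrite ?inE //;
  exact: measurable_nat_prod.
Qed.

Lemma ltr_natr_sqrt (d : nat) (x : R) : 0 < x ->
  (d%:R < Num.sqrt x) = (d%:R ^+ 2 < x).
Proof. by move=> x0; rewrite -(ltr_sqrt _ x0) sqrtr_sqr ger0_norm. Qed.

Lemma P0_lam_absdiff m : m%:R ^+ 2 < 2 * l -> 2 * l <= m.+1%:R ^+ 2 ->
  P0_lam l = pairP l [set w | (absdiff w <= m)%N].
Proof.
move=> lm ml; have l20 : 0 < 2 * l by rewrite mulr_gt0.
rewrite P0_lamE //; congr (pairP l _); apply/seteqP; split => w /=;
  rewrite ltr_natr_sqrt // -!natrX => H.
- rewrite leqNgt; apply/negP => dm; have : 2 * l < 2 * l; last by rewrite ltxx.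
  apply: (le_lt_trans ml); apply: le_lt_trans H.
  by rewrite -natrX ler_nat leq_exp2r.
- by apply: le_lt_trans lm; rewrite -natrX ler_nat leq_exp2r.
Qed.

Lemma skellam_partial_sum n k :
  \sum_(j < n) poisson_pmf l j * poisson_pmf l (j + k) <= skellam l k.
Proof.
rewrite -lee_fin skellam_series //.
apply: le_trans (@nneseries_lim_ge _ _ xpredT 0 n _); last first.
  by move=> j _ _; rewrite lee_fin mulr_ge0 ?poisson_pmf_ge0.
by rewrite sumEFin big_mkord.
Qed.

Lemma skellam_le1_numeric : 16 / 5 <= 2 * l -> 2 * l <= 4 ->
  10 / 21 <= skellam l 0 + 2 * skellam l 1.
Proof.
move=> l1 l2; have s0 := skellam_partial_sum 4 0; have s1 := skellam_partial_sum 4 1.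
apply: le_trans (lerD s0 (ler_wpM2l _ s1)) => //.
rewrite !big_ord_recr !big_ord0 /= /poisson_pmf l0 !factS fact0.
(* Expansion around [l = 2]: [e^(-2 l) = e^(-4) e^(2 z)] with [0 <= z <= 2/5], where [e <= 11/4] and
   three terms of the exponential series bound the factors. *)
pose z := 2 - l; have z0 : 0 <= z by rewrite /z; lra.
have z1 : z <= 2 / 5 by rewrite /z; lra.
have exp_lb : (4 / 11) ^+ 4 * (1 + 2 * z + 2 * z ^+ 2) <= expR (- l) ^+ 2.
  have -> : expR (- l) ^+ 2 = expR (-1) ^+ 4 * expR (2 * z) :> R.
    by rewrite -!expRM_natl -expRD; congr expR; rewrite /z; ring.
  apply: ler_pM.
  - by rewrite exprn_ge0.
  - by rewrite !addr_ge0 ?mulr_ge0 ?exprn_ge0.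
  - rewrite lerXn2r ?nnegrE ?expR_ge0 //.
    have e_le := @expR1_le R; have e_gt0 := expR_gt0 (1 : R).
    by rewrite expRN -[leLHS]invrK lef_pV2 ?posrE ?invr_gt0 //; lra.
  have := exp_coeff_sum_le (2 * z) 3 (mulr_ge0 (ler0n R 2) z0).
  by rewrite !big_ord_recr big_ord0 /= !factS fact0; apply: le_trans; lra.
have lz : l = 2 - z by rewrite /z; ring.
move: (expR (- l)) exp_lb => X X_lb.
(* The four-term partial sums of P(Y = 0) and 2 P(Y = 1), added and divided by [e^(-2 l)]. *)
pose p := 1 + 2 * l + l ^+ 2 + l ^+ 3 + l ^+ 4 / 4 + l ^+ 5 / 6
  + l ^+ 6 / 36 + l ^+ 7 / 72.
have p0 : 0 <= p by rewrite !addr_ge0 ?mulr_ge0 ?exprn_ge0 // ltW.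
have z2 : z ^+ 2 <= 4 / 25 by nra.
(* These products have a second factor positive on [0, 2/5]; together with the even powers of [z]
   they certify a polynomial inequality of degree nine by linear arithmetic. *)
have h3 : 0 <= z * (8 - 39 * z ^+ 2) by apply: mulr_ge0 => //; lra.
have h4 : 0 <= z ^+ 4 * (48 - 31 * z) by apply: mulr_ge0; [exact: exprn_ge0|lra].
have h6 : 0 <= z ^+ 6 * (11 - 3 * z) by apply: mulr_ge0; [exact: exprn_ge0|lra].
have h8 : 0 <= z ^+ 8 * (2 / 5 - z / 30) by apply: mulr_ge0; [exact: exprn_ge0|lra].
have zk k : 0 <= z ^+ k by exact: exprn_ge0.
have := ler_wpM2r p0 X_lb.
have : 10 / 21 <= (4 / 11) ^+ 4 * (1 + 2 * z + 2 * z ^+ 2) * p.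
  rewrite /p lz; have := zk 2%N; have := zk 4%N; have := zk 6%N; have := zk 8%N.
  clear -z0 z2 h3 h4 h6 h8; lra.
move=> /le_trans /[apply] /le_trans; apply.
rewrite le_eqVlt; apply/orP; left; apply/eqP; rewrite /p.
by field.
Qed.

Lemma P0_lam_ge : (c_const <= P0_lam l)%E.
Proof.
have l20 : 0 < 2 * l by rewrite mulr_gt0.
have exN : exists n : nat, 2 * l <= n%:R ^+ 2.
  exists (Num.truncn (2 * l)).+1.
  have := truncn_itv (ltW l20) => /andP[_ /ltW /le_trans]; apply.
  by rewrite -natrX ler_nat -{1}(expn1 _.+1) leq_pexp2l.
(* The least [n] with [2 l <= n^2] is positive; its predecessor is the [m] with
   [m^2 < 2 l <= (m + 1)^2]. *)
have [[|m]] := ex_minnP exN; first by rewrite expr0n /= leNgt l20.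
move=> lm minm.
have ml : m%:R ^+ 2 < 2 * l.
  by rewrite ltNge; apply/negP => /minm; rewrite ltnn.
rewrite c_constE (P0_lam_absdiff m) //.
have c_le := @skellam0_half_le R.
have c21 : (19 / 40 <= 10 / 21 :> R) by lra.
case: m lm ml minm => [|[|m]] lm ml _.
- rewrite (_ : [set w | _] = [set w | absdiff w = 0%N]); last first.
    by apply/seteqP; split => w /=; rewrite leqn0 => /eqP.
  rewrite absdiff0_law lee_fin; apply: skellam0_half_min.
  by rewrite l0; move: lm; rewrite expr1n; lra.
- have [l1|l1] := lerP (2 * l) (16 / 5).
    (* Here [s = 63/10] solves [3 / s = 10/21], and [s^2 = 39.69] exceeds [12 t + 1 <= 39.4]. *)
    apply: le_trans (gauss_bound l l0 1 (63 / 10) _ _ _); [|lra..].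
    rewrite lee_fin; apply: (le_trans c_le); apply: (le_trans c21).
    by rewrite /gauss_const /gauss_slope; lra.
  rewrite absdiff_le1_law lee_fin; apply: (le_trans c_le); apply: (le_trans c21).
  by apply: skellam_le1_numeric; [exact: ltW|move: lm; rewrite -natrX; lra].
have mn : m.+3%:R = m.+2%:R + 1 :> R by rewrite natr1.
have m2 : 2 <= m.+2%:R :> R by rewrite ler_nat.
rewrite mn in lm; have [f23 f_ge] := gauss_value _ _ m2 lm.
apply: le_trans (gauss_bound l l0 m.+2 (7 / 2 * (m.+2%:R + 1)) _ f23 _).
- by rewrite lee_fin; apply: (le_trans c_le); exact: le_trans f_ge.
- by rewrite mulr_gt0 // natr1.
- move: m2; clear; move: (m.+2%:R) => x; lra.
Qed.

Lemma P0_lam_le_P_lam : (P0_lam l <= P_lam l)%E.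
Proof.
by rewrite (P0_lamE l l0) (P_lamE l l0); apply: le_pairP => w /ltW.
Qed.

Lemma P_lam_lt_half : 2 * l < 1 -> P_lam l = (skellam l 0)%:E.
Proof.
move=> l1; rewrite P_lamE // -absdiff0_law; congr (pairP l _).
apply/seteqP; split => w /=; last by move=> ->; exact: sqrtr_ge0.
have s1 : Num.sqrt (2 * l) < 1 by rewrite -[ltRHS]sqrtr1 ltr_sqrt.
by move=> /le_lt_trans /(_ s1); rewrite ltrn1 ltnS leqn0 => /eqP.
Qed.
End lower_bound.

(** * The two infima *)

Section infimum.
Context {R : realType}.

Lemma P0_lam_half : P0_lam (2^-1 : R) = c_const.
Proof.
have h0 : 0 < 2^-1 :> R by rewrite invr_gt0.
have h1 : 2 * 2^-1 = 1 :> R by field.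
rewrite (P0_lam_absdiff _ h0 0) ?h1 ?expr0n ?expr1n //.
rewrite c_constE -absdiff0_law; congr (pairP _ _).
by apply/seteqP; split => w /=; rewrite leqn0 => /eqP.
Qed.

Lemma inf_P0_lam :
  ereal_inf [set @P0_lam R l | l in [set x : R | 0 < x]] = c_const.
Proof.
apply/eqP; rewrite eq_le; apply/andP; split.
  by apply: ereal_inf_lbound; exists 2^-1; rewrite ?P0_lam_half //= invr_gt0.
by apply: le_ereal_inf_tmp => _ [l l0 <-]; exact: P0_lam_ge.
Qed.

(** At [l = 1/2] the closed event also contains [|Y| = 1], so the infimum is approached along [l]
    increasing to 1/2. *)
Lemma inf_P_lam :
  ereal_inf [set @P_lam R l | l in [set x : R | 0 < x]] = c_const.
Proof.
apply/eqP; rewrite eq_le; apply/andP; split; last first.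
  apply: le_ereal_inf_tmp => _ [l l0 <-].
  by apply: le_trans (P0_lam_ge l l0) (P0_lam_le_P_lam l l0).
apply/lee_addgt0Pr => e e0.
have e1 : 0 < 1 + e by lra.
(* Chosen so that [e^(2 l - 1) >= 2 l = 1 / (1 + e)], where the base on the left is Euler's number.
   The loss factor is then at most [1 + e], and the constant is below 1. *)
pose l := (2 * (1 + e))^-1.
have l0 : 0 < l by rewrite invr_gt0 mulr_gt0.
have lE : 2 * l = (1 + e)^-1 by rewrite /l; field; rewrite gt_eqF.
have l1 : 2 * l < 1 by rewrite lE invf_lt1 //; lra.
apply: (@le_trans _ _ (P_lam l)); first by apply: ereal_inf_lbound; exists l.
rewrite P_lam_lt_half // c_constE -EFinD lee_fin.
apply: le_trans (skellam0_le_half l _) _; first by rewrite l0; lra.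
have c1 := @skellam0_half_le R; have c0 := skellam_ge0 (2^-1 : R) 0.
have : expR (1 - 2 * l) <= 1 + e.
  rewrite -[leRHS]invrK -lE -[leLHS]invrK.
  rewrite lef_pV2 ?posrE ?invr_gt0 ?expR_gt0 ?mulr_gt0 //.
  by rewrite -expRN; apply: le_trans (expR_ge1Dx _); lra.
move: (expR _) (skellam _ _) c0 c1 => E c c0 c1 Ee; nra.
Qed.
End infimum.

(** * Convolution semigroups of the Poisson laws and of the laws of Y *)

Section convolution.
Context {R : realType}.
Local Open Scope ereal_scope.

Lemma poisson_pmf_convolution (a b : R) n : (0 < a)%R -> (0 < b)%R ->
  (\sum_(i < n.+1) poisson_pmf a i * poisson_pmf b (n - i) =
   poisson_pmf (a + b) n)%R.
Proof.
move=> a0 b0; rewrite /poisson_pmf a0 b0 addr_gt0 // [(a + b)%R]addrC exprDn.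
rewrite opprD expRD !mulr_suml; apply: eq_bigr => i _.
have i_le : (i <= n)%N by rewrite -ltnS.
rewrite -mulr_natr -(bin_fact i_le) !natrM; field.
by rewrite !pnatr_eq0 -!lt0n !fact_gt0 bin_gt0 i_le.
Qed.

Lemma poisson_convolution (a b : R) (h : nat -> \bar R) :
  (0 < a)%R -> (0 < b)%R -> (forall k, 0 <= h k) ->
  \int[poissonN a]_i \int[poissonN b]_j h (i + j)%N =
  \int[poissonN (a + b)]_k h k.
Proof.
move=> a0 b0 h0; have ab0 : (0 < a + b)%R by exact: addr_gt0.
have pa0 k : 0 <= (poisson_pmf a k)%:E by rewrite lee_fin poisson_pmf_ge0.
have pb0 k : 0 <= (poisson_pmf b k)%:E by rewrite lee_fin poisson_pmf_ge0.
rewrite !integral_poisson //; last by move=> k; exact: integral_ge0.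
(* Extending the terms by 0 for [n < i] turns the triangular sum over [n = i + j] into a full double
   series, whose order can be exchanged. *)
pose F i n : \bar R := if (i <= n)%N then
  (poisson_pmf a i)%:E * ((poisson_pmf b (n - i))%:E * h n) else 0.
have F0 i n : 0 <= F i n.
  rewrite /F; case: ifP => // _.
  exact: mule_ge0 (pa0 i) (mule_ge0 (pb0 _) (h0 n)).
transitivity (\sum_(i <oo) \sum_(n <oo) F i n).
  apply: eq_eseriesr => i _; rewrite integral_poisson //.
  rewrite -nneseriesZl => [|k _]; last by rewrite mule_ge0.
  rewrite [RHS](nneseries_split 0%N i) // add0n big1_seq ?add0e; last first.
    move=> n /andP[_]; rewrite mem_index_iota => /andP[_ ni].
    by rewrite /F leqNgt ni.
  rewrite -nneseries_addn //; apply: eq_eseriesr => j _.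
  by rewrite /F leq_addl addnK addnC.
rewrite (@nneseries_interchange _ F xpredT xpredT) //.
apply: eq_eseriesr => n _.
rewrite (nneseries_split 0%N n.+1) // add0n eseries0 ?adde0; last first.
  by move=> i ni _; rewrite /F leqNgt ni.
rewrite -(poisson_pmf_convolution _ _ n a0 b0) -sumEFin ge0_sume_distrl; last first.
  by move=> i _; rewrite EFinM mule_ge0.
rewrite big_mkord; apply: eq_bigr => i _.
by rewrite /F -ltnS ltn_ord EFinM muleA.
Qed.

(** Exchanging the two middle integrals regroups the sum as [(N_a + N_b) - (N'_a + N'_b)]; Poisson
    convolution then applies to each bracket. *)
Lemma skellam_convolution (a b : R) (h : R -> \bar R) :
  (0 < a)%R -> (0 < b)%R -> (forall x, 0 <= h x) ->
  \int[pairP a]_v \int[pairP b]_w h (Ydiff v + Ydiff w)%R =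
  \int[pairP (a + b)]_w h (Ydiff w).
Proof.
move=> a0 b0 h0; pose G x y : \bar R := h (x%:R - y%:R)%R.
have G0 x y : 0 <= G x y by exact: h0.
rewrite [RHS]ge0_integral_nat_prod // ge0_integral_nat_prod; last first.
  by move=> v; exact: integral_ge0.
transitivity (\int[poissonN a]_i \int[poissonN a]_k \int[poissonN b]_j
    \int[poissonN b]_m G (i + j)%N (k + m)%N).
  apply: eq_integral => i _; apply: eq_integral => k _.
  rewrite ge0_integral_nat_prod => [|w]; last exact: h0.
  apply: eq_integral => j _.
  apply: eq_integral => m _; rewrite /G /Ydiff /= !natrD; congr h; ring.
pose H x := \int[poissonN (a + b)]_y G x y.
transitivity (\int[poissonN a]_i \int[poissonN b]_j H (i + j)%N).
  apply: eq_integral => i _; rewrite ge0_integral_nat_swap; last first.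
    by move=> k j; exact: integral_ge0.
  apply: eq_integral => j _.
  exact: (poisson_convolution _ _ (G (i + j)%N)).
by rewrite poisson_convolution // => k; exact: integral_ge0.
Qed.

End convolution.

(** * Infinite divisibility of Y *)

Section infinitely_divisible.
Context {R : realType}.
Local Open Scope ereal_scope.

Lemma pairP_indic (r : R) (A : set (nat * nat)) :
  \int[pairP r]_w (\1_A w)%:E = pairP r A.
Proof. by rewrite integral_indic ?setIT //; exact: measurable_nat_prod. Qed.

(** Induction on [n]: the space gains a new factor [nat * nat] carrying coordinate [ord0], while the
    old variables read the second component. The law of the sum is carried along in the
    induction. *)
Lemma skellam_iid (l : R) n : (0 < l)%R ->
  exists (d : measure_display) (T : measurableType d) (P : probability T R)
    (Z : 'I_n.+1 -> T -> R),
  [/\ forall i, measurable_fun setT (Z i),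
      mutually_independent P Z,
      forall i B, measurable B ->
        P (Z i @^-1` B) = pairP l (Ydiff @^-1` B) &
      forall B, measurable B ->
        P ((fun w => \sum_(i < n.+1) Z i w)%R @^-1` B) =
        pairP (n.+1%:R * l) (Ydiff @^-1` B)].
Proof.
move=> l0; elim: n => [|n [d [T [P [Z [mZ iZ eZ sZ]]]]]].
  exists _, _, (pairP l : probability _ R), (fun=> Ydiff); split.
  - by move=> i; exact: measurable_fun_nat_prod.
  - move=> B mB; rewrite big_ord1; congr (pairP l _); apply/seteqP.
    by split=> [w /(_ ord0 I)|w Bw i _] //; rewrite (ord1 i).
  - by [].
  - move=> B mB; rewrite mul1r; congr (pairP l _).
    by apply/seteqP; split=> w /=; rewrite big_ord1.
pose P' : probability _ R := (pairP l : probability _ R) \x P.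
pose Z' (i : 'I_n.+2) (w : (nat * nat) * T) : R :=
  if unlift ord0 i is Some j then Z j w.2 else Ydiff w.1.
have Z'0 : Z' ord0 = Ydiff \o fst by apply/funext => w; rewrite /Z' unlift_none.
have Z'S j : Z' (lift ord0 j) = Z j \o snd.
  by apply/funext => w; rewrite /Z' liftK.
have mY : measurable_fun setT (Ydiff : _ -> R) by exact: measurable_fun_nat_prod.
have mZB j (B : set R) : measurable B -> measurable (Z j @^-1` B).
  by move=> mB; rewrite -[_ @^-1` _]setTI; exact: mZ.
have mZ' i : measurable_fun setT (Z' i).
  case: (unliftP ord0 i) => [j ->|->].
    by rewrite Z'S; apply: measurableT_comp.
  by rewrite Z'0; apply: measurableT_comp.
have sumZ' w : (\sum_(i < n.+2) Z' i w = Ydiff w.1 + \sum_(i < n.+1) Z i w.2)%R.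
  rewrite big_ord_recl Z'0; congr (_ + _)%R; apply: eq_bigr => i _.
  by rewrite -[RHS]/((Z i \o snd) w) -Z'S.
have P'X (A : set (nat * nat)) (C : set T) : measurable C ->
    P' (A `*` C) = pairP l A * P C.
  by move=> mC; apply: product_measure1E => //; exact: measurable_nat_prod.
have P'0 (B : set R) : P' (Z' ord0 @^-1` B) = pairP l (Ydiff @^-1` B).
  rewrite Z'0 (_ : (_ \o _) @^-1` _ = (Ydiff @^-1` B) `*` setT).
    by rewrite P'X // probability_setT mule1.
  by apply/seteqP; split=> w //= [].
have P'S j (B : set R) : measurable B ->
    P' (Z' (lift ord0 j) @^-1` B) = P (Z j @^-1` B).
  move=> mB; rewrite Z'S (_ : (_ \o _) @^-1` _ = setT `*` (Z j @^-1` B)).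
    rewrite P'X; last exact: mZB.
    rewrite (_ : pairP l setT = 1) ?mul1e //.
    exact: (@probability_setT _ _ _ (pairP l : probability _ R)).
  by apply/seteqP; split=> w //= [].
exists _, _, P', Z'; split; first exact: mZ'.
- move=> B mB; rewrite big_ord_recl.
  rewrite (_ : \bigcap_(i in _) _ = (Ydiff @^-1` B ord0) `*`
      \bigcap_(i in [set: 'I_n.+1]) (Z i @^-1` B (lift ord0 i))); last first.
    apply/seteqP; split=> [w Bw|w [Bw0 Bw] i _].
      split; first by have := Bw ord0 I; rewrite Z'0.
      by move=> i _; have := Bw (lift ord0 i) I; rewrite Z'S.
    by case: (unliftP ord0 i) => [j ->|->]; rewrite ?Z'S ?Z'0 //=; exact: Bw.
  rewrite P'X; last by apply: fin_bigcap_measurable => // i _; exact: mZB.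
  rewrite P'0; congr (_ * _).
  transitivity (\prod_(i < n.+1) P (Z i @^-1` B (lift ord0 i))).
    by apply: (iZ (fun i => B (lift ord0 i))).
  by apply: eq_bigr => i _; rewrite P'S.
- move=> i B mB; case: (unliftP ord0 i) => [j ->|-> //].
  by rewrite P'S // eZ.
move=> B mB.
have indicY (r : R) c :
    \int[pairP r]_w (\1_B (c + Ydiff w)%R)%:E =
    pairP r (Ydiff @^-1` [set y | B (c + y)%R]).
  rewrite -[RHS](pairP_indic _ (Ydiff @^-1` [set y | B (c + y)%R])).
  by apply: eq_integral => w _.
(* The product measure integrates the masses of sections. By [sZ], the section over [v] has the mass
   of [B] translated by [Ydiff v]. *)
transitivity (\int[pairP l]_v \int[pairP (n.+1%:R * l)]_w
    (\1_B (Ydiff v + Ydiff w)%R)%:E).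
  apply: eq_integral => v _ /=; rewrite indicY -sZ; last first.
    rewrite -[X in measurable X]setTI.
    have mD : measurable_fun setT (fun y : R => Ydiff v + y)%R.
      by exact: measurable_realfun.measurable_funD.
    exact: mD.
  by congr (P _); apply/seteqP; split=> w /=; rewrite /xsection /= inE /= sumZ'.
rewrite (skellam_convolution l (n.+1%:R * l) (fun x => (\1_B x)%:E)) //; last first.
  by rewrite mulr_gt0.
rewrite -[in RHS]natr1 mulrDl mul1r [in RHS]addrC.
rewrite (_ : Ydiff @^-1` B = Ydiff @^-1` [set y | B (0 + y)%R]).
  by rewrite -indicY; apply: eq_integral => w _; rewrite add0r.
by apply/seteqP; split=> w /=; rewrite add0r.
Qed.

(** The summands are differences of independent Poisson variables with parameter [l] divided by
    their number. *)
Lemma pairP_infinitely_divisible (l : R) : (0 < l)%R ->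
  infinitely_divisible (pairP l) Ydiff.
Proof.
move=> l0 [//|n] _; have nl0 : (0 < l / n.+1%:R)%R by rewrite divr_gt0.
have [d [T [P [Z [mZ iZ eZ sZ]]]]] := skellam_iid _ n nl0.
exists d, T, P, Z; split; [exact: mZ|exact: iZ| |].
  by move=> i j B mB; rewrite !eZ.
have lE : (n.+1%:R * (l / n.+1%:R) = l)%R by rewrite mulrCA divff ?mulr1.
by move=> B mB; rewrite (sZ B mB) lE.
Qed.

End infinitely_divisible.

Theorem theorem4p3 (R : realType) :
  [/\ ereal_inf [set @P_lam R l | l in [set x : R | 0 < x]] = c_const,
      ereal_inf [set @P0_lam R l | l in [set x : R | 0 < x]] = c_const,
      @P0_lam R (2^-1) = c_const &
      (@P_I R <= c_const)%E].
Proof.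
split; [exact: inf_P_lam|exact: inf_P0_lam|exact: P0_lam_half|].
(* Each [P_lam l] is one of the values in [ID_values], so [P_I] is an infimum over a larger set. *)
rewrite -inf_P_lam; apply: ereal_inf_le_tmp => _ [l l0 <-].
exists _, _, (pairP l : probability _ R), Ydiff; split.
- exact: measurable_fun_nat_prod.
- exact: pairP_infinitely_divisible.
- exact: Ydiff_Lfun2.
- by [].
Qed.
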